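(* Let $U$ and $V$ be real normed spaces. Then $\mathcal{C}(U,V)\subseteq \mathcal{C}_{st}(U,V)=\mathcal{C}_{st}^{n}(U,V)$.
   Context: The natural density of $K\subseteq\mathbb{N}$ is $\delta(K)=\lim_{n\to\infty}\frac1n|\{k\le n: k\in K\}|$ when the limit exists. A sequence $(x_n)$ in a normed space is statistically convergent to $x$ if $\delta(\{k:\|x_k-x\|\ge\varepsilon\})=0$ for every $\varepsilon>0$. $\theta$ denotes the zero vector. $\mathcal{C}(U,V)$ is the set of norm-continuous linear operators $U\to V$. $\mathcal{C}_{st}^{n}(U,V)$ is the set of norm-statistically continuous ($n$-$st$-continuous) linear operators $S:U\to V$, i.e. those such that whenever $(x_n)$ converges in norm to $\theta$ in $U$, $(S(x_n))$ converges statistically to $\theta$ in $V$. $\mathcal{C}_{st}(U,V)$ is the set of statistically continuous ($st$-continuous) linear operators $S:U\to V$, i.e. those such that whenever $(x_n)$ converges statistically to $\theta$ in $U$, $(S(x_n))$ converges statistically to $\theta$ in $V$. *)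

(* Defs.v *)
From HB Require Import structures.
From mathcomp Require Import all_boot all_order all_algebra.
From mathcomp Require Import all_classical all_reals all_analysis.

Set Implicit Arguments.
Unset Strict Implicit.
Unset Printing Implicit Defensive.

Import Order.TTheory GRing.Theory Num.Theory.
Import numFieldNormedType.Exports.

Local Open Scope classical_set_scope.
Local Open Scope ring_scope.

(* The paper's indices are taken in [nat], so that [0] counts among the
   [k <= n]; this changes the count by at most one and hence no density.
   At [n = 0] the ratio is [0] by the convention [0^-1 = 0]. *)
Definition density_ratio (R : realType) (K : set nat) (n : nat) : R :=
  n%:R^-1 * #|[pred k : 'I_n.+1 | (k : nat) \in K]|%:R.

Definition has_natural_density (R : realType) (K : set nat) (d : R) : Prop :=
  density_ratio R K n @[n --> \oo] --> d.

Definition stat_converges (R : realType) (U : normedModType R)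
    (x : nat -> U) (l : U) : Prop :=
  forall eps : R, 0 < eps ->
    has_natural_density [set k : nat | eps <= `|x k - l|] (0 : R).

Definition continuous_operators (R : realType) (U V : normedModType R) :
    set {linear U -> V} :=
  [set S : {linear U -> V} | continuous S].

Definition nst_continuous_operators (R : realType) (U V : normedModType R) :
    set {linear U -> V} :=
  [set S : {linear U -> V} | forall x : nat -> U,
     x n @[n --> \oo] --> (0 : U) -> stat_converges (fun n => S (x n)) 0].

Definition st_continuous_operators (R : realType) (U V : normedModType R) :
    set {linear U -> V} :=
  [set S : {linear U -> V} | forall x : nat -> U,
     stat_converges x 0 -> stat_converges (fun n => S (x n)) 0].

Arguments continuous_operators {R} U V _.
Arguments nst_continuous_operators {R} U V _.
Arguments st_continuous_operators {R} U V _.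

(* Main.v *)
(* A linear operator is continuous iff it is bounded.  If [`|S x| <= M * `|x|],
   then [{k | eps <= `|S x_k|}] lies in [{k | eps / M <= `|x_k|}], so continuity
   implies [st]-continuity; and norm convergence implies statistical convergence
   since finite sets have density [0].  Conversely an unbounded [S] is not
   [n]-[st]-continuous: choose [x_n] with [`|x_n| < 1 / (n + 1)] and
   [`|S x_n| = 1].  Hence the three classes in fact coincide. *)
Require Import Defs.
From HB Require Import structures.
From mathcomp Require Import all_boot all_order all_algebra.
From mathcomp Require Import all_classical all_reals all_analysis.
Import Order.TTheory GRing.Theory Num.Theory.
Import numFieldNormedType.Exports.

Local Open Scope classical_set_scope.
Local Open Scope ring_scope.

Lemma density_ratio_ge0 (R : realType) (K : set nat) (n : nat) :
  0 <= density_ratio R K n.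
Proof. by rewrite mulr_ge0 ?invr_ge0 ?ler0n. Qed.

Lemma le_density_ratio (R : realType) (K L : set nat) (n : nat) :
  K `<=` L -> density_ratio R K n <= density_ratio R L n.
Proof.
move=> KL; rewrite ler_wpM2l ?invr_ge0 ?ler0n// ler_nat subset_leq_card//.
by apply/fintype.subsetP => k; rewrite !inE; exact: KL.
Qed.

Lemma has_natural_density0_sub (R : realType) (K L : set nat) :
  K `<=` L -> has_natural_density L (0 : R) -> has_natural_density K (0 : R).
Proof.
move=> KL; apply: squeeze_cvgr (cvg_cst 0).
by apply: nearW => n; rewrite density_ratio_ge0 le_density_ratio.
Qed.

(** At most [N] indices are ever counted, so the ratio is at most [N / n], which tends to 0. *)
Lemma has_natural_density0_bounded (R : realType) (K : set nat) (N : nat) :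
  K `<=` `I_N -> has_natural_density K (0 : R).
Proof.
move=> KN; apply/cvgr0Pnorm_le => e e0; near=> n.
have n0 : 0 < n%:R :> R by rewrite ltr0n; near: n; exact: nbhs_infty_gt.
rewrite ger0_norm ?density_ratio_ge0// /density_ratio ler_pdivrMl//.
have /le_trans -> // : #|[pred k : 'I_n.+1 | (k : nat) \in K]|%:R <= N%:R :> R.
  (* The counted ordinals, read as naturals, form a duplicate-free list contained in [iota 0 N]. *)
  rewrite ler_nat cardE -(size_map val) -[leqRHS](size_iota 0).
  apply: uniq_leq_size; first by rewrite map_inj_uniq ?enum_uniq//; exact: val_inj.
  by move=> _ /mapP[k + ->]; rewrite mem_enum mem_iota !inE => /KN.
rewrite -ler_pdivrMr//; near: n; exact: nbhs_infty_ger.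
Unshelve. all: by end_near. Qed.

(** For [n > 0] the ratio is [(n + 1) / n], which never drops below 1. *)
Lemma not_has_natural_density0_setT (R : realType) :
  ~ has_natural_density setT (0 : R).
Proof.
move=> /cvgr0_norm_lt /(_ 1 ltr01) near_lt1; near \oo => n.
have n0 : 0 < n%:R :> R by rewrite ltr0n; near: n; exact: nbhs_infty_gt.
have : `|density_ratio R setT n| < 1 by near: n.
rewrite ger0_norm ?density_ratio_ge0// /density_ratio ltr_pdivrMl// mulr1.
rewrite ltr_nat (eq_card (B := 'I_n.+1)) ?card_ord ?ltnNge ?leqnSn//.
by move=> k; rewrite !inE in_setT.
Unshelve. all: by end_near. Qed.

Lemma cvg_stat_converges (R : realType) (U : normedModType R)
    (x : nat -> U) (l : U) : x n @[n --> \oo] --> l -> stat_converges x l.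
Proof.
move=> /cvgrPdistC_lt xl e /xl[N _ xN].
apply: (@has_natural_density0_bounded _ _ N) => k /= ek.
by rewrite ltnNge; apply/negP => /xN /=; rewrite ltNge ek.
Qed.

Lemma continuous_st_continuous (R : realType) (U V : normedModType R) :
  continuous_operators U V `<=` st_continuous_operators U V.
Proof.
(* The bound [M] is chosen positive so that [e / M] is a valid threshold for [x]. *)
move=> S /linear_bounded_continuous/linear_boundedP/pinfty_ex_gt0[M M0 SM].
move=> x x0 e e0; apply: has_natural_density0_sub (x0 (e / M) _).
  move=> k /=; rewrite !subr0 ler_pdivrMr// mulrC => /le_trans; exact.
by rewrite divr_gt0.
Qed.

Lemma st_nst_continuous (R : realType) (U V : normedModType R) :
  st_continuous_operators U V `<=` nst_continuous_operators U V.
Proof. by move=> S Sst x /cvg_stat_converges; exact: Sst. Qed.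

Lemma unbounded_linear_seq (R : realType) (U V : normedModType R)
    (S : {linear U -> V}) : ~ continuous S ->
  exists2 x : nat -> U, x n @[n --> \oo] --> (0 : U) & forall n, `|S (x n)| = 1.
Proof.
move=> Sdisc.
have unbounded n : exists x : U, `|S x| = 1 /\ `|x| < n.+1%:R^-1.
  apply: contrapT => noSx; apply/Sdisc/linear_bounded_continuous.
  (* If no such [x] exists, [n + 1] bounds [S], and hence so does every larger [r]. *)
  apply/linear_boundedP; exists n.+1%:R; split => // r nr x.
  apply: le_trans (ler_wpM2r _ (ltW nr)) => //.
  rewrite leNgt; apply/negP => xS; apply: noSx.
  have Sx0 : 0 < `|S x| by apply: le_lt_trans xS; rewrite mulr_ge0.
  (* Normalising the image of a vector that violates the bound turns [(n + 1) * |x| < |S x|] into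
     norm less than [1 / (n + 1)]. *)
  exists (`|S x|^-1 *: x); rewrite linearZ !normrZ normfV normr_id.
  by rewrite mulVf ?gt_eqF// ltr_pdivrMl// ltr_pdivlMr// mulrC.
have [x xP] := choice unbounded.
exists x => [|n]; last by have [] := xP n.
apply/norm_cvg0P; apply: squeeze_cvgr (cvg_cst 0) cvg_harmonic.
by apply: nearW => n; rewrite normr_ge0 ltW//; have [] := xP n.
Qed.

Lemma nst_continuous_continuous (R : realType) (U V : normedModType R) :
  nst_continuous_operators U V `<=` continuous_operators U V.
Proof.
move=> S Snst; apply: contrapT => /unbounded_linear_seq[x x0 Sx1].
(* Every [S (x k)] has norm 1, so with threshold 1 every index is exceptional. *)
apply: (@not_has_natural_density0_setT R).
apply: has_natural_density0_sub (Snst x x0 1 ltr01) => k _ /=.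
by rewrite subr0 Sx1.
Qed.

Theorem proposition3p3 (R : realType) (U V : normedModType R) :
  continuous_operators U V `<=` st_continuous_operators U V /\
  st_continuous_operators U V = nst_continuous_operators U V.
Proof.
split; first exact: continuous_st_continuous.
apply/seteqP; split; first exact: st_nst_continuous.
(* The reverse inclusion passes through norm continuity. *)
by apply: subset_trans; [exact: nst_continuous_continuous
                        |exact: continuous_st_continuous].
Qed.
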